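(* Let $\mathcal{L}$ be the extended Schrödinger-Virasoro Lie algebra over a field $\mathbb{F}$ of characteristic zero, and let $\mathcal{V}=\mathcal{L}\otimes\mathcal{L}$ be regarded as an $\mathcal{L}$-module under the diagonal adjoint action. Then $\mathrm{Der}(\mathcal{L},\mathcal{V})=\mathrm{Inn}(\mathcal{L},\mathcal{V})$ (equivalently, the first cohomology group $H^1(\mathcal{L},\mathcal{L}\otimes\mathcal{L})$ is trivial).
   Context: $\mathbb{F}$ is a field of characteristic zero; all vector spaces and tensor products are over $\mathbb{F}$. The extended Schrödinger-Virasoro Lie algebra $\mathcal{L}$ is the Lie algebra with $\mathbb{F}$-basis $\{L_n,M_n,N_n,Y_p \mid n\in\mathbb{Z},\ p\in\mathbb{Z}+\tfrac12\}$ and (antisymmetric) brackets, for $m,n\in\mathbb{Z}$, $p,q\in\mathbb{Z}+\tfrac12$: $[L_m,L_n]=(n-m)L_{m+n}$, $[L_m,N_n]=nN_{m+n}$, $[L_m,M_n]=nM_{m+n}$, $[L_n,Y_p]=(p-\tfrac n2)Y_{p+n}$, $[N_m,Y_p]=Y_{m+p}$, $[N_m,M_n]=2M_{m+n}$, $[Y_p,Y_q]=(q-p)M_{p+q}$, $[M_n,Y_p]=[N_m,N_n]=[M_m,M_n]=0$. The diagonal adjoint action is $x\cdot\sum_i a_i\otimes b_i=\sum_i([x,a_i]\otimes b_i+a_i\otimes[x,b_i])$. $\mathrm{Der}(\mathcal{L},\mathcal{V})$ is the space of linear maps $D:\mathcal{L}\to\mathcal{V}$ with $D([x,y])=x\cdot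 D(y)-y\cdot D(x)$ for all $x,y\in\mathcal{L}$. $\mathrm{Inn}(\mathcal{L},\mathcal{V})$ is the subspace of inner derivations, i.e. those of the form $x\mapsto x\cdot v$ for some $v\in\mathcal{V}$. One has $H^1(\mathcal{L},\mathcal{V})\cong\mathrm{Der}(\mathcal{L},\mathcal{V})/\mathrm{Inn}(\mathcal{L},\mathcal{V})$. *)

(* Defs.v *)
From HB Require Import structures.
From mathcomp Require Import all_boot all_order all_algebra.
From mathcomp Require Import finmap monalg ring.

Set Implicit Arguments.
Unset Strict Implicit.
Unset Printing Implicit Defensive.

Import GRing.Theory.
Local Open Scope ring_scope.

(* {malg F[K]} is the F-vector space with basis <<k>>, k : K.  [linext f] is   *)
(* the linear map sending <<k>> to f k.                                        *)
Section LinearExtension.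
Variables (F : fieldType) (K : choiceType) (W : lmodType F).
Implicit Types (f : K -> W) (g : {malg F[K]}).

Definition linext f g : W := \sum_(k <- msupp g) g@_k *: f k.

Lemma linextw f g (d : {fset K}) :
  (msupp g `<=` d)%fset -> linext f g = \sum_(k <- d) g@_k *: f k.
Proof.
move=> le_d; apply: big_fset_incl => // k _ /mcoeff_outdom ->.
by rewrite scale0r.
Qed.

Lemma linext_is_linear f : linear (linext f).
Proof.
move=> a x y; set d := (msupp x `|` msupp y)%fset.
have xd : (msupp x `<=` d)%fset by apply: fsubsetUl.
have yd : (msupp y `<=` d)%fset by apply: fsubsetUr.
have zd : (msupp (a *: x + y) `<=` d)%fset.
  by apply: fsubset_trans (msuppD_le _ _) _; apply: fsetSU; apply: msuppZ_le.
rewrite (linextw _ xd) (linextw _ yd) (linextw _ zd) scaler_sumr -big_split /=.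
by apply: eq_bigr => k _; rewrite mcoeffD mcoeffZ scalerDl scalerA.
Qed.

HB.instance Definition _ f :=
  GRing.isLinear.Build F {malg F[K]} W *:%R (linext f) (linext_is_linear f).

Lemma linextU f k : linext f << k >> = f k.
Proof. by rewrite /linext msuppU oner_eq0 big_seq_fset1 mcoeffUU scale1r. Qed.

Lemma malgUZ (c : F) (k : K) : << c *g k >> = c *: << k >> :> {malg F[K]}.
Proof. by apply/malgP => j; rewrite mcoeffZ !mcoeffU mulr_natr. Qed.

Lemma linext_eq (p q : {linear {malg F[K]} -> W}) :
  (forall k, p << k >> = q << k >>) -> p =1 q.
Proof.
move=> pq g; rewrite (monalgE g) !linear_sum.
by apply: eq_bigr => k _; rewrite malgUZ !linearZ pq.
Qed.

Lemma eq_linext f1 f2 : f1 =1 f2 -> linext f1 =1 linext f2.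
Proof. by move=> e x; apply: eq_bigr => k _; rewrite e. Qed.

Lemma linext_lin f1 f2 (a : F) x :
  linext (fun k => a *: f1 k + f2 k) x = a *: linext f1 x + linext f2 x.
Proof.
rewrite /linext scaler_sumr -big_split; apply: eq_bigr => k _.
by rewrite scalerDr !scalerA mulrC.
Qed.

End LinearExtension.

(* The tensor product of free modules: free on the product of the bases.       *)
Section Tensor.
Variables (F : fieldType) (K : choiceType).
Local Notation V := {malg F[K]}.
Local Notation V2 := {malg F[(K * K)%type]}.

Definition tens (a b : V) : V2 :=
  linext (fun i => linext (fun j => << (i, j) >> : V2) b) a.

Lemma tensU i j : tens << i >> << j >> = << (i, j) >>.
Proof. by rewrite /tens !linextU. Qed.

Definition tensr b a := tens a b.

Lemma tens_linearl b : linear (tensr b).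
Proof. by move=> c x y; rewrite /tensr /tens linearP. Qed.

Lemma tens_linearr a : linear (tens a).
Proof.
move=> c x y; rewrite /tens -linext_lin; apply: eq_linext => i.
by rewrite linearP.
Qed.

HB.instance Definition _ b :=
  GRing.isLinear.Build F V V2 *:%R (tensr b) (tens_linearl b).
HB.instance Definition _ a :=
  GRing.isLinear.Build F V V2 *:%R (tens a) (tens_linearr a).

Lemma tens_universal (W : lmodType F) (f : V -> V -> W) :
    (forall a, linear (f a)) -> (forall b, linear (f^~ b)) ->
  exists g : {linear V2 -> W},
    (forall a b, g (tens a b) = f a b) /\
    (forall h : {linear V2 -> W},
       (forall a b, h (tens a b) = f a b) -> h =1 g).
Proof.
move=> flr fll.
pose fr a : {linear V -> W} :=
  HB.pack (f a) (GRing.isLinear.Build F V W *:%R (f a) (flr a)).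
pose fl b : {linear V -> W} :=
  HB.pack (f^~ b) (GRing.isLinear.Build F V W *:%R (f^~ b) (fll b)).
pose g : {linear V2 -> W} := linext (fun ij : K * K => f << ij.1 >> << ij.2 >>).
exists g; split=> [a b | h hE].
  pose gl : {linear V -> W} := g \o (tensr b).
  apply: (@linext_eq _ _ _ gl (fl b)) => i /=.
  pose gr : {linear V -> W} := g \o tens << i >>.
  apply: (@linext_eq _ _ _ gr (fr << i >>)) => j /=.
  by rewrite tensU linextU.
by apply: linext_eq => -[i j]; rewrite -tensU hE tensU /= linextU.
Qed.

End Tensor.

(* Basis of the extended Schrodinger-Virasoro algebra.  The half-integer index *)
(* p = k + 1/2 is encoded by k : int, so that bY k stands for Y_(k + 1/2).     *)
Inductive esv_basis := bL of int | bM of int | bN of int | bY of int.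

Definition esv_basis_code (b : esv_basis) : (int + int) + (int + int) :=
  match b with
  | bL n => inl (inl n) | bM n => inl (inr n)
  | bN n => inr (inl n) | bY k => inr (inr k)
  end.

Definition esv_basis_decode (c : (int + int) + (int + int)) : esv_basis :=
  match c with
  | inl (inl n) => bL n | inl (inr n) => bM n
  | inr (inl n) => bN n | inr (inr k) => bY k
  end.

Lemma esv_basis_codeK : cancel esv_basis_code esv_basis_decode.
Proof. by case. Qed.

HB.instance Definition _ := Countable.copy esv_basis (can_type esv_basis_codeK).

Notation esv F := {malg F[esv_basis]}.
Notation esv2 F := {malg F[(esv_basis * esv_basis)%type]}.

Section ESV.
Variable F : fieldType.
Local Notation L := (esv F).
Local Notation V := (esv2 F).

Definition half_int (k : int) : F := k%:~R + 2^-1.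

(* For p = k + 1/2 and q = l + 1/2 we have p + q = k + l + 1.                  *)
Definition esv_bracket_basis (a b : esv_basis) : L :=
  match a, b with
  | bL m, bL n => (n - m)%:~R *: << bL (m + n) >>
  | bL m, bN n => n%:~R *: << bN (m + n) >>
  | bN n, bL m => - n%:~R *: << bN (m + n) >>
  | bL m, bM n => n%:~R *: << bM (m + n) >>
  | bM n, bL m => - n%:~R *: << bM (m + n) >>
  | bL n, bY k => (half_int k - n%:~R / 2) *: << bY (k + n) >>
  | bY k, bL n => - (half_int k - n%:~R / 2) *: << bY (k + n) >>
  | bN m, bY k => << bY (m + k) >>
  | bY k, bN m => - << bY (m + k) >>
  | bN m, bM n => 2 *: << bM (m + n) >>
  | bM n, bN m => - 2 *: << bM (m + n) >>
  | bY k, bY l => (half_int l - half_int k) *: << bM (k + l + 1) >>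
  | bM _, bY _ | bY _, bM _ | bN _, bN _ | bM _, bM _ => 0
  end.

Definition esv_bracket (x y : L) : L :=
  linext (fun a => linext (esv_bracket_basis a) y) x.

(* Diagonal adjoint action; [esv_actE] gives its value on all pure tensors.    *)
Definition esv_act (x : L) (v : V) : V :=
  linext (fun ij : esv_basis * esv_basis =>
    tens (esv_bracket x << ij.1 >>) << ij.2 >> +
    tens << ij.1 >> (esv_bracket x << ij.2 >>)) v.

Definition esv_Der (D : {linear L -> V}) : Prop :=
  forall x y, D (esv_bracket x y) = esv_act x (D y) - esv_act y (D x).

Definition esv_Inn (D : {linear L -> V}) : Prop :=
  exists v : V, forall x, D x = esv_act x v.

Definition esv_bracketr (y x : L) : L := esv_bracket x y.

Lemma esv_bracket_linearl y : linear (esv_bracketr y).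
Proof. by move=> c x x'; rewrite /esv_bracketr /esv_bracket linearP. Qed.

Lemma esv_bracket_linearr x : linear (esv_bracket x).
Proof.
move=> c y y'; rewrite /esv_bracket -linext_lin; apply: eq_linext => i.
by rewrite linearP.
Qed.

HB.instance Definition _ y :=
  GRing.isLinear.Build F L L *:%R (esv_bracketr y) (esv_bracket_linearl y).
HB.instance Definition _ x :=
  GRing.isLinear.Build F L L *:%R (esv_bracket x) (esv_bracket_linearr x).

Lemma esv_act_linearr x : linear (esv_act x).
Proof. by move=> c v w; rewrite /esv_act linearP. Qed.

HB.instance Definition _ x :=
  GRing.isLinear.Build F V V *:%R (esv_act x) (esv_act_linearr x).

Lemma esv_bracketU a b : esv_bracket << a >> << b >> = esv_bracket_basis a b.
Proof. by rewrite /esv_bracket !linextU. Qed.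

Lemma esv_actE x a b :
  esv_act x (tens a b) = tens (esv_bracket x a) b + tens a (esv_bracket x b).
Proof.
pose l1 b : {linear L -> V} := esv_act x \o (tensr b).
pose r1 b : {linear L -> V} :=
  ((tensr b \o esv_bracket x) \+ (tensr (esv_bracket x b)))%R.
apply: (@linext_eq _ _ _ (l1 b) (r1 b)) => i /=.
pose l2 : {linear L -> V} := esv_act x \o (tens << i >>).
pose r2 : {linear L -> V} :=
  (tens (esv_bracket x << i >>) \+ (tens << i >> \o esv_bracket x))%R.
by apply: (@linext_eq _ _ _ l2 r2) => j /=; rewrite tensU /esv_act linextU.
Qed.

Lemma esv_bracketC x y : esv_bracket x y = - esv_bracket y x.
Proof.
pose l1 y : {linear L -> L} := esv_bracketr y.
pose r1 y : {linear L -> L} := \- esv_bracket y.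
apply: (@linext_eq _ _ _ (l1 y) (r1 y)) => a /=.
pose r2 : {linear L -> L} := \- esv_bracketr << a >>.
apply: (@linext_eq _ _ _ (esv_bracket << a >>) r2) => b /=.
rewrite /esv_bracketr !esv_bracketU {l1 r1 r2}.
have [e eE] : {e : esv_basis -> L | forall k, << k >> = e k}.
  by exists (mkmalgU^~ 1).
case: a => m; case: b => n /=; rewrite ?eE ?scaleNr ?oppr0 ?opprK //.
- by rewrite -scaleNr -rmorphN opprB [n + m]addrC.
- by rewrite -scaleNr opprB [n + m]addrC.
Qed.

End ESV.

Section ESVCharZero.
Variable F : fieldType.
Hypothesis charF : [pchar F] =i pred0.
Local Notation L := (esv F).
Local Notation V := (esv2 F).

Lemma esv_bracketxx (x : L) : esv_bracket x x = 0.
Proof.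
have n2 : (2 : F) != 0 by rewrite ((pcharf0P F).1 charF).
apply/eqP; have /eqP := esv_bracketC x x.
by rewrite -addr_eq0 -mulr2n -scaler_nat scaler_eq0 (negPf n2).
Qed.

Lemma half_intD k l : half_int F k + half_int F l = (k + l + 1)%:~R.
Proof.
have n2 : (2 : F) != 0 by rewrite ((pcharf0P F).1 charF).
by rewrite /half_int !rmorphD /=; field.
Qed.

Local Ltac unify_idx e :=
  repeat match goal with
  | |- context [e (?C ?i)] =>
    match goal with
    | |- context [e (C ?i')] =>
      tryif constr_eq i i' then fail else (replace i' with i by ring)
    end
  end.

(* All terms of each instance of the identity are multiples of one basis      *)
(* vector w; [collect] reduces the instance to an identity of coefficients.   *)
Let collect_eq (w u v : L) a b : u = a *: w -> v = b *: w -> a = b -> u = v.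
Proof. by move=> -> -> ->. Qed.
Let collectD (w u v : L) a b :
  u = a *: w -> v = b *: w -> u + v = (a + b) *: w.
Proof. by move=> -> ->; rewrite scalerDl. Qed.
Let collectN (w u : L) a : u = a *: w -> - u = (- a) *: w.
Proof. by move=> ->; rewrite scaleNr. Qed.
Let collectZ (w u : L) c a : u = a *: w -> c *: u = (c * a) *: w.
Proof. by move=> ->; rewrite scalerA. Qed.
Let collect0 (w : L) : 0 = (0 : F) *: w.
Proof. by rewrite scale0r. Qed.
Let collect1 (w : L) : w = (1 : F) *: w.
Proof. by rewrite scale1r. Qed.

Local Ltac collect_step w :=
  lazymatch goal with
  | |- w = _ => apply: collect1
  | |- _ + _ = _ => apply: collectD; collect_step w
  | |- - _ = _ => apply: collectN; collect_step w
  | |- _ *: _ = _ => apply: collectZ; collect_step w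
  | |- 0 = _ => apply: collect0
  end.

Local Ltac collect e :=
  let w := lazymatch goal with
           | |- context [e ?b] => constr:(e b)
           | |- _ => constr:(e (bL 0))
           end in
  apply: (@collect_eq w); [collect_step w | collect_step w | ].

Lemma esv_jacobi (x y z : L) :
  esv_bracket x (esv_bracket y z) =
  esv_bracket (esv_bracket x y) z + esv_bracket y (esv_bracket x z).
Proof.
pose B (u : L) : {linear L -> L} := esv_bracketr u.
pose A (u : L) : {linear L -> L} := esv_bracket u.
pose r1 : {linear L -> L} := (B z \o B y) \+ (A y \o B z).
apply: (@linext_eq _ _ _ (B (esv_bracket y z)) r1) => a /=.
pose l2 : {linear L -> L} := A << a >> \o B z.
pose r2 : {linear L -> L} := (B z \o A << a >>) \+ B (esv_bracket << a >> z).
apply: (@linext_eq _ _ _ l2 r2) => b /=.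
pose l3 : {linear L -> L} := A << a >> \o A << b >>.
pose r3 : {linear L -> L} :=
  (A (esv_bracket << a >> << b >>)) \+ (A << b >> \o A << a >>).
apply: (@linext_eq _ _ _ l3 r3) => c /=.
have n2 : (2 : F) != 0 by rewrite ((pcharf0P F).1 charF).
have BZl t u v : esv_bracket (t *: u : L) v = t *: esv_bracket u v.
  exact: (linearZ_LR (B v)).
have B0l v : esv_bracket (0 : L) v = 0 by exact: (linear0 (B v)).
have BNl u v : esv_bracket (- u : L) v = - esv_bracket u v.
  exact: (linearN (B v)).
have BZr t u v : esv_bracket u (t *: v : L) = t *: esv_bracket u v.
  exact: (linearZ_LR (A u)).
have B0r u : esv_bracket u (0 : L) = 0 by exact: (linear0 (A u)).
have BNr u v : esv_bracket u (- v : L) = - esv_bracket u v.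
  exact: (linearN (A u)).
have [e eE] : {e : esv_basis -> L | forall k, << k >> = e k}.
  by exists (mkmalgU^~ 1).
rewrite /B /esv_bracketr !esv_bracketU.
have Be a' b' : esv_bracket (e a') (e b') = esv_bracket_basis F a' b'.
  by rewrite -!eE esv_bracketU.
have BE := (BZl, B0l, BNl, BZr, B0r, BNr, Be).
clear l2 r1 r2 l3 r3 A B BZl B0l BNl BZr B0r BNr Be x y z.
move: (@esv_bracket F) BE => br BE.
case: a => m; case: b => n; case: c => k;
  rewrite /= ?eE ?BE /= ?eE ?BE /= ?eE {BE eE br}; unify_idx e; collect e.
all: rewrite /half_int ?(rmorphB, rmorphD, rmorph1) /=; field => //.
Qed.

Let zmod_aux (U : zmodType) (a b c d p q : U) :
  (a - b) + (c - d) = ((a + p) + (q + c)) - ((b + q) + (p + d)).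
Proof.
rewrite [q + c]addrC [a + p + _]addrACA [p + d]addrC [b + q + _]addrACA.
by rewrite [b + d + _]addrC [q + p]addrC addrKA opprD addrACA.
Qed.

Lemma esv_act_bracket (x y : L) (v : V) :
  esv_act (esv_bracket x y) v =
  esv_act x (esv_act y v) - esv_act y (esv_act x v).
Proof.
pose l : {linear V -> V} := esv_act (esv_bracket x y).
pose r : {linear V -> V} :=
  (esv_act x \o esv_act y) \+ \- (esv_act y \o esv_act x).
apply: (@linext_eq _ _ _ l r) => -[i j]; rewrite /l /r /= {l r}.
have br u : esv_bracket (esv_bracket x y) u =
    esv_bracket x (esv_bracket y u) - esv_bracket y (esv_bracket x u).
  by rewrite (esv_jacobi x y u) addrK.
have tl (a b c : L) : tens (a - b) c = tens a c - tens b c.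
  exact: (linearB (tensr c)).
have tr (a b c : L) : tens a (b - c) = tens a b - tens a c.
  exact: (linearB (tens a)).
have act2 (u w a b : L) : esv_act u (esv_act w (tens a b)) =
    (tens (esv_bracket u (esv_bracket w a)) b +
     tens (esv_bracket w a) (esv_bracket u b)) +
    (tens (esv_bracket u a) (esv_bracket w b) +
     tens a (esv_bracket u (esv_bracket w b))).
  rewrite (esv_actE w a b); apply: etrans (linearD (esv_act u) _ _) _.
  exact: (f_equal2 _ (esv_actE _ _ _) (esv_actE _ _ _)).
rewrite -tensU (act2 x y) (act2 y x) (esv_actE _ << i >>).
rewrite (br << i >>) (br << j >>).
rewrite tl tr.
exact: zmod_aux.
Qed.

End ESVCharZero.

(* Main.v *)
Require Import Defs.
From HB Require Import structures.
From mathcomp Require Import all_boot all_order all_algebra.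
From mathcomp Require Import finmap monalg ring zify.

(** An inner derivation is a derivation because the diagonal adjoint action is
a module structure.  For the converse let D be a derivation of the algebra into
V = L (x) L.  The proof subtracts inner derivations from D until nothing is
left, and it looks only at the values of D on the N_m and the Y_p, that is, at
the three families of relations [N_m, N_n] = 0, [N_m, Y_p] = Y_(m+p) and
[Y_p, Y_q] = (q - p) M_(p+q), compared coefficient by coefficient.  Every
coefficient function occurring below has finite support; the recurring
argument is that a relation forces it to be constant along an infinite
antidiagonal of indices, hence to vanish.

The element N_0 acts diagonally, with weight 0 on L and N, 1 on Y and 2 on M.
Dividing the weight-w part of D(N_0) by w, for w <> 0, gives a vector whose
inner derivation removes that part; then D preserves weights
([Der_weighted]), so D(N_m) has coefficients only on pairs from {L, N}, and
D(Y_p) only on pairs made of one Y and one element of {L, N}.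

Next D is made to vanish on all N_m.  Commutation of N_1 with N_n kills the
L (x) L part of D(N_n) ([Der_N_LL]).  The relation
D(Y_(m+p)) = N_m . D(Y_p) - Y_p . D(N_m) writes a coefficient of D(N_m) as
a difference of a function at m + p and at p, with a result that does not
involve p; so it is additive in m, hence m times its value at 1
([Der_N_NL], [Der_N_NN]).  This linear dependence on m is exactly the shape
of N_m . v for v in L (x) L + L (x) N + N (x) L: the action of N_m sends
L_i to -m N_(m+i).  The vector v can thus be read off from D(N_1) and
D(Y_(1/2)) ([Der_N_into_NN], [Der_kills_N]).

Once D(N_m) = 0, D commutes with every N_m, and finiteness of supports
leaves D(Y_p) = sum a_ij Y_(p+i) (x) N_j + b_ij N_i (x) Y_(p+j) with a, b
independent of p.  The Y (x) Y part of the relation for [Y_p, Y_q] gives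
a = b ([kills_N_sym]), and D(Y_p) is then the action of Y_p on
- sum a_ij N_i (x) N_j ([Der_kills_NY]).

Finally, if D kills all N_m and Y_p, it kills M_n, a multiple of a bracket of
two Y's, and D(L_n) is annihilated by N_0 and by all Y_p, which forces it to
vanish ([esv_ann_weight0]). *)

Set Implicit Arguments.
Unset Strict Implicit.
Unset Printing Implicit Defensive.

Import Order.TTheory GRing.Theory Num.Theory.
Local Open Scope ring_scope.

(** * Coefficients in free modules *)

Section FiniteSupport.
Variables (F : fieldType) (K : choiceType).
Implicit Types (g : {malg F[K]}) (k : K).

Lemma mcoeff1U k k' : (<< k >> : {malg F[K]})@_k' = (k == k')%:R.
Proof. by rewrite mcoeffU. Qed.

Lemma mcoeff_linext (K' : choiceType) (f : K' -> {malg F[K]})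
    (g : {malg F[K']}) k :
  (linext f g)@_k = \sum_(k' <- msupp g) g@_k' * (f k')@_k.
Proof. by rewrite /linext raddf_sum; apply: eq_bigr => k' _; exact: mcoeffZ. Qed.

Lemma mcoeff_sumU g k : g@_k = \sum_(k' <- msupp g) g@_k' * (k' == k)%:R.
Proof.
rewrite [in LHS](monalgE g) raddf_sum; apply: eq_bigr => k' _ /=.
by rewrite mcoeffU mulr_natr.
Qed.

(** A function obtained by reindexing the coefficients of g along a partial
injection psi again has finite support, since phi sends the support of g onto
a set that contains it. *)
Lemma malg_pullback g (psi : K -> option K) (phi : K -> K) :
    (forall k k', psi k = Some k' -> phi k' = k) ->
  exists v : {malg F[K]}, forall k, v@_k = oapp (fun k' => g@_k') 0 (psi k).
Proof.
move=> phiE; pose f k := oapp (fun k' => g@_k') 0 (psi k).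
pose s := undup [seq phi k | k <- msupp g].
exists (\sum_(k <- s) f k *: << k >>) => k.
rewrite raddf_sum /= (eq_bigr (fun k' => f k' * (k' == k)%:R)); last first.
  by move=> k' _; rewrite mcoeffZ mcoeff1U.
have [ks | kNs] := boolP (k \in s).
  rewrite (bigD1_seq k) ?undup_uniq //= eqxx mulr1 big1 ?addr0 // => k' ne.
  by rewrite (negPf ne) mulr0.
rewrite big_seq big1 => [|k' k's]; last first.
  by have [e | _] := eqVneq k' k; rewrite ?mulr0 // -e k's in kNs *.
apply/esym; case E: (psi k) => [k'|] //=.
apply: mcoeff_outdom; apply: contra kNs => k's.
by rewrite mem_undup -(phiE _ _ E) map_f.
Qed.

End FiniteSupport.

(** * Coefficients of the action of N_m and Y_p *)

(** Locked, because unification of coefficients at different basis vectors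
would otherwise unfold the construction of those vectors. *)
HB.lock Definition dcoef (F : fieldType) (D : {linear esv F -> esv2 F})
  (a i j : esv_basis) : F := (D << a >>)@_(i, j).

Section Coefficients.
Variable F : fieldType.
Local Notation B := esv_basis.
Local Notation L := (esv F).
Local Notation V := (esv2 F).

Definition idx (b : B) : int :=
  match b with bL n => n | bM n => n | bN n => n | bY k => k end.

Lemma esv_basis_eqE (a b : B) : (a == b) =
  match a, b with
  | bL m, bL n | bM m, bM n | bN m, bN n | bY m, bY n => m == n
  | _, _ => false
  end.
Proof. by case: a b => m [] n; first [apply/eqP/eqP => [[]|->] | apply/eqP]. Qed.

Lemma esv2_bounded (v : V) :
  exists R : int, forall i j, R < idx i \/ R < idx j -> v@_(i, j) = 0.
Proof.
pose top (k : B * B) : nat := (`|idx k.1| + `|idx k.2|)%N.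
exists (\max_(k <- msupp v) top k)%N%:Z => i j ijR.
apply: mcoeff_outdom; apply/negP => ijv.
have := @leq_bigmax_seq _ (enum_fset (msupp v)) xpredT top _ ijv isT.
rewrite /top /=.
set R := (\max_(_ <- _) _)%N in ijR *.
by case: ijR; lia.
Qed.

Lemma mcoeff_tens (x y : L) i j : (tens x y)@_(i, j) = x@_i * y@_j.
Proof.
rewrite mcoeff_linext (mcoeff_sumU x i) mulr_suml; apply: eq_bigr => a _.
rewrite mcoeff_linext (mcoeff_sumU y j) mulr_sumr mulr_sumr.
apply: eq_bigr => b _; rewrite mcoeff1U xpair_eqE -mulnb natrM; ring.
Qed.

(** The transpose of ad N_m: if g gives the coefficients of u, then
[coadN m g] gives those of the bracket of N_m and u.  Coefficients of D(x) can
then be compared without expanding D(x) in the basis. *)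
Definition coadN (m : int) (g : B -> F) (b : B) : F :=
  match b with
  | bL _ => 0
  | bN i => - m%:~R * g (bL (i - m))
  | bY i => g (bY (i - m))
  | bM i => 2 * g (bM (i - m))
  end.

(** The transpose of ad Y_(k + 1/2).  At M_i the preimage is Y_(l + 1/2) with
k + l + 1 = i. *)
Definition coadY (k : int) (g : B -> F) (b : B) : F :=
  match b with
  | bL _ | bN _ => 0
  | bY i => - (half_int F k - (i - k)%:~R / 2) * g (bL (i - k)) - g (bN (i - k))
  | bM i => (half_int F (i - k - 1) - half_int F k) * g (bY (i - k - 1))
  end.

(** Coefficients of x . v from those of v, when c is the transpose of ad x:
the Leibniz rule acts on each tensor factor separately. *)
Definition coact (c : (B -> F) -> B -> F) (g : B -> B -> F) (i j : B) : F :=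
  c (fun i' => g i' j) i + c (fun j' => g i j') j.

Local Notation coefs v := (fun i j : B => (v : V)@_(i, j)).

(** The transpose of ad a, characterised by its values on the coefficient
functions of basis vectors.  Extensionality is required because c acts on
functions. *)
Definition is_coad (a : B) (c : (B -> F) -> B -> F) : Prop :=
  [/\ forall t g1 g2 i, c (fun b => t * g1 b + g2 b) i = t * c g1 i + c g2 i,
      forall g1 g2, g1 =1 g2 -> c g1 =1 c g2
    & forall b i, (esv_bracket_basis F a b)@_i = c (fun b' => (b == b')%:R) i].

Lemma mcoeff_act a c v i j : is_coad a c ->
  (esv_act << a >> v)@_(i, j) = coact c (coefs v) i j.
Proof.
case=> c_lin c_ext cE.
have c0 b : c (fun=> 0) b = 0.
  have := c_lin 1 (fun=> 0) (fun=> 0) b.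
  rewrite (c_ext _ (fun=> 0)) => [|b']; last by rewrite mul1r addr0.
  by rewrite mul1r => /esym/eqP; rewrite -subr_eq0 addrK => /eqP.
have c_sum (T : Type) (s : seq T) t (g : T -> B -> F) b :
    c (fun b' => \sum_(k <- s) t k * g k b') b = \sum_(k <- s) t k * c (g k) b.
  elim: s => [|k s IHs].
    by rewrite big_nil -(c0 b); apply: c_ext => b'; rewrite big_nil.
  rewrite big_cons -IHs -c_lin; apply: c_ext => b'; exact: big_cons.
have vE i' j' : v@_(i', j') =
    \sum_(k <- msupp v) (v@_k * (k.2 == j')%:R) * (k.1 == i')%:R.
  rewrite [LHS]mcoeff_sumU; apply: eq_bigr => -[k1 k2] _ /=.
  by rewrite xpair_eqE -mulnb natrM mulrA mulrAC.
have vE' i' j' : v@_(i', j') =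
    \sum_(k <- msupp v) (v@_k * (k.1 == i')%:R) * (k.2 == j')%:R.
  by rewrite vE; apply: eq_bigr => k _; rewrite mulrAC.
rewrite /coact (c_ext _ _ (vE^~ j)) (c_ext _ _ (vE' i)) !c_sum.
rewrite mcoeff_linext -big_split; apply: eq_bigr => -[k1 k2] _ /=.
rewrite -!mulrA -mulrDr mcoeffD; congr (_ * (_ + _)).
  apply: etrans (mcoeff_tens _ _ _ _) _.
  by rewrite esv_bracketU cE mcoeff1U mulrC.
apply: etrans (mcoeff_tens _ _ _ _) _.
by rewrite esv_bracketU cE mcoeff1U.
Qed.

Lemma coadN_correct m : is_coad (bN m) (coadN m).
Proof.
split=> [t g1 g2 [] i /= | g1 g2 g12 [] i /= | [] n [] i /=]; rewrite ?g12 //;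
  try ring;
  rewrite ?mcoeff0 ?mcoeffZ ?mcoeff1U !esv_basis_eqE ?mulr0 ?[_ == _ - _]eq_sym
    ?subr_eq ?[m + _]addrC ?[n + m == _]eq_sym //.
Qed.

Lemma coadY_correct k : is_coad (bY k) (coadY k).
Proof.
split=> [t g1 g2 [] i /= | g1 g2 g12 [] i /= | [] n [] i /=]; rewrite ?g12 //;
  try ring;
  rewrite ?mcoeffN ?mcoeff0 ?mcoeffZ ?mcoeff1U ?esv_basis_eqE ?mulr0 ?subr0
    ?oppr0 ?sub0r ?[n == _]eq_sym ?subr_eq ?[n + k]addrC //.
- rewrite [i == _]eq_sym; have [<-|_] := eqVneq; last by rewrite !mulr0.
  by congr (- (_ - _ / 2) * _); congr _%:~R; ring.
- by rewrite eq_sym.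
- rewrite [n + 1 + k]addrC addrA [i == _]eq_sym.
  have [<-|_] := eqVneq; last by rewrite !mulr0.
  by congr ((half_int F _ - _) * _); ring.
Qed.

Lemma mcoeff_actN m v i j :
  (esv_act << bN m >> v)@_(i, j) = coact (coadN m) (coefs v) i j.
Proof. by apply: mcoeff_act; apply: coadN_correct. Qed.

Lemma mcoeff_actY k v i j :
  (esv_act << bY k >> v)@_(i, j) = coact (coadY k) (coefs v) i j.
Proof. by apply: mcoeff_act; apply: coadY_correct. Qed.

(** Exchange of the two tensor factors.  It commutes with the action, so
composing a derivation with it gives a derivation, and each statement on
coefficients yields its mirror image. *)
Definition flip (v : V) : V := linext (fun k : B * B => << (k.2, k.1) >> : V) v.

Lemma flip_is_linear : linear flip.
Proof. exact: linext_is_linear. Qed.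

HB.instance Definition _ :=
  GRing.isLinear.Build F V V *:%R flip flip_is_linear.

Lemma mcoeff_flip v i j : (flip v)@_(i, j) = v@_(j, i).
Proof.
rewrite mcoeff_linext [RHS]mcoeff_sumU; apply: eq_bigr => -[k1 k2] _ /=.
by rewrite mcoeff1U !xpair_eqE andbC.
Qed.

Lemma flip_tens (x y : L) : flip (tens x y) = tens y x.
Proof.
apply/malgP => -[i j]; rewrite mcoeff_flip (mcoeff_tens x y).
by rewrite (mcoeff_tens y x) mulrC.
Qed.

Lemma esv_act_flip x v : esv_act x (flip v) = flip (esv_act x v).
Proof.
apply: (@linext_eq _ _ _ (esv_act x \o flip) (flip \o esv_act x)) => -[i j] /=.
rewrite -tensU.
apply: etrans (f_equal (esv_act x) (flip_tens _ _)) _.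
apply: etrans (esv_actE _ _ _) _; apply/esym.
apply: etrans (f_equal flip (esv_actE _ _ _)) _.
apply: etrans (linearD flip _ _) _; rewrite addrC.
exact: (f_equal2 _ (flip_tens _ _) (flip_tens _ _)).
Qed.

Lemma esv_Der_flip (D : {linear L -> V}) : esv_Der D -> esv_Der (flip \o D).
Proof. by move=> derD x y /=; rewrite derD linearB /= !esv_act_flip. Qed.

(** * Subtracting inner derivations *)

(** The action in its algebra argument, as a bundled linear map: the inner
derivation of v. *)
Definition esv_actr (v : V) (x : L) : V := esv_act x v.

Lemma esv_act_linearl v : linear (esv_actr v).
Proof.
move=> c x y; rewrite /esv_actr /esv_act -linext_lin; apply: eq_linext => -[i j].
have brE z : esv_bracket (c *: x + y) z = c *: esv_bracket x z + esv_bracket y z.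
  exact: (esv_bracket_linearl z).
rewrite !brE /= (tens_linearr << i >>) scalerDr addrACA.
by congr (_ + _); exact: (tens_linearl << j >>).
Qed.

HB.instance Definition _ v :=
  GRing.isLinear.Build F L V *:%R (esv_actr v) (esv_act_linearl v).

Definition sub_inner (D : {linear L -> V}) (v : V) : {linear L -> V} :=
  D \+ \- esv_actr v.

Lemma sub_innerE D v x : sub_inner D v x = D x - esv_act x v.
Proof. by []. Qed.

Lemma esv_Inn_sub_inner D v : esv_Inn (sub_inner D v) -> esv_Inn D.
Proof.
case=> w wE; exists (w + v) => x.
by rewrite linearD /= -wE sub_innerE subrK.
Qed.

End Coefficients.

Section Derivations.
Variables (F : fieldType) (charF : [pchar F] =i pred0).
Local Notation B := esv_basis.
Local Notation L := (esv F).
Local Notation V := (esv2 F).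
Local Notation coefs v := (fun i j : B => (v : V)@_(i, j)).
Implicit Types (D : {linear L -> V}) (g : B -> B -> F).

Lemma esv_Der_sub_inner D v : esv_Der D -> esv_Der (sub_inner D v).
Proof.
move=> derD x y; rewrite !sub_innerE derD (esv_act_bracket charF) !linearB /=.
exact: addrACA.
Qed.

Lemma intr_inj0 (m : int) : m%:~R = 0 :> F -> m = 0.
Proof.
move=> m0; apply/eqP; rewrite -absz_eq0 -(proj1 (pcharf0P F) charF).
by case: m m0 => n //= /eqP; rewrite ?NegzE ?rmorphN ?oppr_eq0.
Qed.

Lemma half_intB k l : half_int F k - half_int F l = (k - l)%:~R.
Proof. by rewrite /half_int rmorphB /=; ring. Qed.

Section Relations.
Variables (D : {linear L -> V}) (derD : esv_Der D).

Lemma Der_relNN m n i j :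
  coact (coadN m) (dcoef D (bN n)) i j = coact (coadN n) (dcoef D (bN m)) i j.
Proof.
rewrite dcoef.unlock -!mcoeff_actN; apply/eqP; rewrite -subr_eq0 -mcoeffB -derD.
by rewrite esv_bracketU linear0 mcoeff0.
Qed.

Lemma Der_relNY m k i j :
  dcoef D (bY (m + k)) i j =
  coact (coadN m) (dcoef D (bY k)) i j - coact (coadY k) (dcoef D (bN m)) i j.
Proof.
by rewrite dcoef.unlock -mcoeff_actN -mcoeff_actY -mcoeffB -derD esv_bracketU.
Qed.

Lemma Der_relYY k l i j :
  (l - k)%:~R * dcoef D (bM (k + l + 1)) i j =
  coact (coadY k) (dcoef D (bY l)) i j - coact (coadY l) (dcoef D (bY k)) i j.
Proof.
rewrite dcoef.unlock -!mcoeff_actY -mcoeffB -derD esv_bracketU /= linearZ mcoeffZ.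
by rewrite half_intB.
Qed.

Lemma dcoef_sub_innerN v m i j :
  dcoef (sub_inner D v) (bN m) i j =
  dcoef D (bN m) i j - coact (coadN m) (coefs v) i j.
Proof. by rewrite dcoef.unlock sub_innerE mcoeffB mcoeff_actN. Qed.

Lemma dcoef_sub_innerY v k i j :
  dcoef (sub_inner D v) (bY k) i j =
  dcoef D (bY k) i j - coact (coadY k) (coefs v) i j.
Proof. by rewrite dcoef.unlock sub_innerE mcoeffB mcoeff_actY. Qed.

Lemma dcoef_flip a i j : dcoef (@flip F \o D) a i j = dcoef D a j i.
Proof. by rewrite dcoef.unlock mcoeff_flip. Qed.

Lemma dcoef_bounded a :
  exists R : int, forall i j, R < idx i \/ R < idx j -> dcoef D a i j = 0.
Proof. by rewrite dcoef.unlock; exact: esv2_bounded. Qed.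
End Relations.

(** * Reduction to weight zero under N_0 *)

(** The eigenvalue of ad N_0. *)
Definition wt (b : B) : nat :=
  match b with bL _ | bN _ => 0 | bY _ => 1 | bM _ => 2 end.

Definition weighted D : Prop :=
  (forall m i j, (wt i + wt j != 0)%N -> dcoef D (bN m) i j = 0) /\
  (forall k i j, (wt i + wt j != 1)%N -> dcoef D (bY k) i j = 0).

Lemma coactN0 g i j : coact (coadN 0) g i j = (wt i + wt j)%N%:R * g i j.
Proof. by case: i j => i [] j; rewrite /coact /= ?subr0 natrD; ring. Qed.

Lemma coactN_wt m g :
    (forall i j, (wt i + wt j != 0)%N -> g i j = 0) ->
  forall i j, (wt i + wt j != 0)%N -> coact (coadN m) g i j = 0.
Proof.
by move=> g0 [] i [] j //= _; rewrite /coact /= ?g0 //= ?mulr0 ?addr0.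
Qed.

Lemma coactY_wt k g :
    (forall i j, (wt i + wt j != 0)%N -> g i j = 0) ->
  forall i j, (wt i + wt j != 1)%N -> coact (coadY k) g i j = 0.
Proof.
move=> g0 [] i [] j //= _; rewrite /coact /= ?(g0 (bL _)) ?(g0 (bN _)) //=;
by rewrite ?g0 //= ?mulr0 ?subr0 ?addr0.
Qed.

(** If D(N_0) has weight 0, then comparing weights in the relation for
[N_0, x] = w x shows that (N_0 - w) D(x) has weight w; as N_0 is diagonal,
D(x) itself has weight w.  The vector v below makes D(N_0) of weight 0: its
coefficients are those of D(N_0) divided by the weight, and the convention
0^-1 = 0 leaves out weight 0. *)
Lemma Der_weighted D : esv_Der D ->
  exists v, weighted (sub_inner D v).
Proof.
move=> derD.
pose v := linext (fun k : B * B => (wt k.1 + wt k.2)%N%:R^-1 *: << k >> : V)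
                 (D << bN 0 >>).
exists v.
have vE i j : v@_(i, j) = (wt i + wt j)%N%:R^-1 * dcoef D (bN 0) i j.
  rewrite dcoef.unlock mcoeff_linext [in RHS]mcoeff_sumU mulr_sumr.
  apply: eq_bigr => k _; rewrite mcoeffZ mcoeff1U mulrCA.
  by have [->|_] := eqVneq; rewrite ?mulr0.
have n0 n : (n%:R == 0 :> F) = (n == 0)%N by rewrite (proj1 (pcharf0P F) charF).
have D0 i j : (wt i + wt j != 0)%N -> dcoef (sub_inner D v) (bN 0) i j = 0.
  move=> w0; rewrite dcoef_sub_innerN coactN0 vE mulrA divff ?n0 //.
  by rewrite mul1r subrr.
have derD' := esv_Der_sub_inner v derD.
split=> [m i j w0 | k i j w1].
  have := Der_relNN derD' 0 m i j; rewrite coactN0 (coactN_wt _ D0) // => /eqP.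
  by rewrite mulf_eq0 n0 (negPf w0) => /eqP.
have := Der_relNY derD' 0 k i j; rewrite coactN0 (coactY_wt _ D0) // subr0 add0r.
move/esym/eqP; rewrite -subr_eq0 -{2}[dcoef _ (bY k) i j]mul1r -mulrBl mulf_eq0.
case/orP => [|/eqP //]; case: (wt i + wt j)%N w1 => [|n] w1.
  by rewrite sub0r oppr_eq0 oner_eq0.
by rewrite mulrSr addrK n0 => /eqP n1; rewrite n1 in w1.
Qed.

(** * Vanishing on the N_m *)

Lemma additive_intE (f : int -> F) :
  (forall m n, f (m + n) = f m + f n) -> forall m, f m = m%:~R * f 1.
Proof.
move=> fD; have f0 : f 0 = 0.
  by apply: (addIr (f 0)); rewrite -fD addr0 add0r.
elim/int_rect => [|n IHn|n IHn]; first by rewrite f0 mul0r.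
  by rewrite intS fD IHn rmorphD /= mulrDl mul1r.
apply: (addIr (f 1)); rewrite -fD (_ : - n.+1%:Z + 1 = - n%:Z); last by lia.
by rewrite IHn intS opprD rmorphD /=; ring.
Qed.

(** Let e be the L (x) L coefficients of D(N_1).  The N (x) L and L (x) N parts
of N_1 . D(N_n) = N_n . D(N_1) express the L (x) L part of D(N_n) as n times a
shift of e in the first, respectively the second index.  So e is constant
along an antidiagonal. *)
Lemma Der_N_LL D (derD : esv_Der D) n i j : dcoef D (bN n) (bL i) (bL j) = 0.
Proof.
have left_shift m i' j' :
    dcoef D (bN m) (bL i') (bL j') = m%:~R * dcoef D (bN 1) (bL (i' + 1 - m)) (bL j').
  have := Der_relNN derD 1 m (bN (i' + 1)) (bL j').
  by rewrite /coact /= addrK !addr0 mulN1r mulNr => /oppr_inj.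
have right_shift m i' j' :
    dcoef D (bN m) (bL i') (bL j') = m%:~R * dcoef D (bN 1) (bL i') (bL (j' + 1 - m)).
  have := Der_relNN derD 1 m (bL i') (bN (j' + 1)).
  by rewrite /coact /= addrK !add0r mulN1r mulNr => /oppr_inj.
have [R farR] := dcoef_bounded D (bN 1).
suff e0 i' j' : dcoef D (bN 1) (bL i') (bL j') = 0 by rewrite left_shift e0 mulr0.
(* A shift that leaves the support of D(N_1). *)
pose m : int := (`|R| + `|i'| + 2)%N.
have := right_shift m (i' + m - 1) j'; rewrite left_shift.
move/(mulfI (contra_not_neq (@intr_inj0 m) _)).
rewrite (farR (bL (i' + m - 1))) /=; last by left; lia.
by rewrite (_ : i' + m - 1 + 1 - m = i') => [->//|]; [lia | ring].
Qed.

(** The Y (x) L part of D(Y_(n+k)) = N_n . D(Y_k) - Y_k . D(N_n) reads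
f(n) = x(n + k) - x(k) for every k, where f(n) is an N (x) L coefficient of
D(N_n) and x(k) a coefficient of D(Y_k).  Hence f is additive. *)
Lemma Der_N_NL D (derD : esv_Der D) m i j :
  dcoef D (bN m) (bN i) (bL j) = m%:~R * dcoef D (bN 1) (bN (i - m + 1)) (bL j).
Proof.
pose x k i' := dcoef D (bY k) (bY (i' + k)) (bL j).
pose f n := dcoef D (bN n) (bN (i - m + n)) (bL j).
have fE n k : f n = x (n + k) (i - m) - x k (i - m).
  have := Der_relNY derD n k (bY (i - m + n + k)) (bL j).
  rewrite /coact /= !addr0 addrK (Der_N_LL derD) mulr0 sub0r opprK.
  rewrite addrAC addrK -/(f n) /x addrA addrAC => ->.
  by rewrite addrAC subrr add0r.
have fD n k : f (n + k) = f n + f k.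
  by rewrite (fE _ 0) (fE n k) (fE k 0) !addr0 subrKA.
by have := additive_intE fD m; rewrite /f subrK.
Qed.

Lemma Der_N_LN D (derD : esv_Der D) m i j :
  dcoef D (bN m) (bL i) (bN j) = m%:~R * dcoef D (bN 1) (bL i) (bN (j - m + 1)).
Proof.
by have := Der_N_NL (esv_Der_flip derD) m j i; rewrite !dcoef_flip.
Qed.

(** The vector in L (x) L that accounts for the N (x) L part of D(N_m) is the
one that accounts for its L (x) N part.  By the N (x) N part of the relation
for [N_m, N_1] the difference of the two candidates is constant along
antidiagonals. *)
Lemma Der_N_LN_NL D (derD : esv_Der D) i j :
  dcoef D (bN 1) (bL i) (bN (j + 1)) = dcoef D (bN 1) (bN (i + 1)) (bL j).
Proof.
have [R farR] := dcoef_bounded D (bN 1).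
pose m : int := (`|R| + `|i| + 2)%N.
have m0 : m%:~R != 0 :> F by apply: contra_not_neq (@intr_inj0 m) _; lia.
have := Der_relNN derD m 1 (bN (i + m)) (bN (j + 1)).
rewrite /coact /= (Der_N_NL derD m) (Der_N_LN derD m).
have -> : i + m - m = i by ring.
have -> : i + m - 1 = i + (m - 1) by ring.
have -> : j + 1 - m = j - m + 1 by ring.
rewrite addrK (farR (bN (i + m))) /=; last by left; lia.
rewrite (farR (bL (i + (m - 1)))) /=; last by left; lia.
by rewrite !mulr0 add0r addr0 mulN1r mulNr => /oppr_inj /(mulfI m0).
Qed.

Lemma weighted_sub_inner D (v : V) : weighted D ->
    (forall i j, (wt i + wt j != 0)%N -> v@_(i, j) = 0) ->
  weighted (sub_inner D v).
Proof.
case=> wN wY wv; split=> m i j wij.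
  by rewrite dcoef_sub_innerN coactN_wt // wN // subrr.
by rewrite dcoef_sub_innerY coactY_wt // wY // subrr.
Qed.

Definition is_N (b : B) : bool := if b is bN _ then true else false.

Definition N_into_NN D : Prop :=
  forall m i j, ~~ (is_N i && is_N j) -> dcoef D (bN m) i j = 0.

Lemma dcoef_pullback D a (psi : B * B -> option (B * B)) (phi : B * B -> B * B) :
    (forall k k', psi k = Some k' -> phi k' = k) ->
  exists v : V, forall i j,
    v@_(i, j) = oapp (fun k => dcoef D a k.1 k.2) 0 (psi (i, j)).
Proof.
move=> psiK; have [v vE] := malg_pullback (D << a >>) psiK.
by exists v => i j; rewrite vE dcoef.unlock; case: (psi _) => [[]|].
Qed.

Lemma Der_N_into_NN D : esv_Der D -> weighted D ->
  exists v, weighted (sub_inner D v) /\ N_into_NN (sub_inner D v).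
Proof.
move=> derD wD.
(* The coefficient of N_m . (L_i (x) L_j) at L_i (x) N_(j+m) is -m. *)
have [|u uE] := @dcoef_pullback D (bN 1)
  (fun k => if k is (bL i, bL j) then Some (bL i, bN (j + 1)) else None)
  (fun k => if k is (bL i, bN j) then (bL i, bL (j - 1)) else k).
  by move=> [[] i [] j] k' //= [<-] /=; rewrite addrK.
have uD : weighted (sub_inner D (- u)).
  apply: weighted_sub_inner => // i j.
  by case: i j => i [] j //= _; rewrite mcoeffN uE /= oppr0.
exists (- u); split=> // m i j NNij.
have [wij|/uD.1 //] := eqVneq (wt i + wt j)%N 0%N.
rewrite dcoef_sub_innerN /coact.
case: i j NNij wij => i [] j //= _ _; rewrite ?mcoeffN ?uE /= ?oppr0 ?mulr0.
- by rewrite (Der_N_LL derD) addr0 subrr.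
- rewrite (Der_N_LN derD) add0r; ring.
- by rewrite (Der_N_NL derD) -(Der_N_LN_NL derD) addr0 mulrNN subrr.
Qed.

Lemma Der_Y_YL D k i j : esv_Der D -> N_into_NN D ->
  dcoef D (bY k) (bY i) (bL j) = dcoef D (bY 0) (bY (i - k)) (bL j).
Proof.
move=> derD NND; have := Der_relNY derD k 0 (bY i) (bL j).
by rewrite /coact /= !NND //= mulr0 !addr0 !subr0 => ->.
Qed.

(** The Y (x) N part of the relation for [N_n, Y_k] has, besides differences
of a function y at n + k and k, the term coming from N_n acting on the Y (x) L
part of D(Y_k).  That term is linear in n; moved to the left it leaves an
additive function f of n. *)
Lemma Der_N_NN D m i j : esv_Der D -> N_into_NN D ->
  dcoef D (bN m) (bN i) (bN j) =
  m%:~R * dcoef D (bY 0) (bY i) (bL (j - m)) +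
  m%:~R * (dcoef D (bN 1) (bN (i - m + 1)) (bN j) -
           dcoef D (bY 0) (bY (i - m + 1)) (bL (j - 1))).
Proof.
move=> derD NND.
pose y k i' := dcoef D (bY k) (bY (i' + k)) (bN j).
pose f n := dcoef D (bN n) (bN (i - m + n)) (bN j) -
            n%:~R * dcoef D (bY 0) (bY (i - m + n)) (bL (j - n)).
have fE n k : f n = y (n + k) (i - m) - y k (i - m).
  have := Der_relNY derD n k (bY (i - m + n + k)) (bN j).
  rewrite /coact /= addrK (Der_Y_YL _ _ _ derD NND) addrK.
  rewrite (NND _ (bL _) (bN j)) // mulr0 addr0 sub0r opprK.
  rewrite [i - m + n + k - n]addrAC addrK /y addrA addrAC => -> //.
  by rewrite /f mulNr; ring.
have fD n k : f (n + k) = f n + f k.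
  by rewrite (fE _ 0) (fE n k) (fE k 0) !addr0 subrKA.
have := additive_intE fD m; rewrite /f subrK mulr1z mul1r => <-; ring.
Qed.

Definition kills_N D : Prop := forall m i j, dcoef D (bN m) i j = 0.

Lemma Der_kills_N D : esv_Der D -> weighted D -> N_into_NN D ->
  exists v, weighted (sub_inner D v) /\ kills_N (sub_inner D v).
Proof.
move=> derD wD NND.
(* For w = l L_i (x) N_j + x N_i (x) L_j, the vector N_m . w has coefficient
   -m l at N_(i+m) (x) N_j and -m x at N_i (x) N_(j+m); l and x are read off
   from the two terms of [Der_N_NN], where u1 - u2 gives l and u3 gives x. *)
have [|u1 u1E] := @dcoef_pullback D (bN 1)
  (fun k => if k is (bL i, bN j) then Some (bN (i + 1), bN j) else None)
  (fun k => if k is (bN i, bN j) then (bL (i - 1), bN j) else k).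
  by move=> [[] i [] j] k' //= [<-]; rewrite addrK.
have [|u2 u2E] := @dcoef_pullback D (bY 0)
  (fun k => if k is (bL i, bN j) then Some (bY (i + 1), bL (j - 1)) else None)
  (fun k => if k is (bY i, bL j) then (bL (i - 1), bN (j + 1)) else k).
  by move=> [[] i [] j] k' //= [<-]; rewrite addrK subrK.
have [|u3 u3E] := @dcoef_pullback D (bY 0)
  (fun k => if k is (bN i, bL j) then Some (bY i, bL j) else None)
  (fun k => if k is (bY i, bL j) then (bN i, bL j) else k).
  by move=> [[] i [] j] k' //= [<-].
pose v := u2 - u1 - u3.
have vE i j : v@_(i, j) = match i, j with
    | bL i, bN j => dcoef D (bY 0) (bY (i + 1)) (bL (j - 1)) -
                    dcoef D (bN 1) (bN (i + 1)) (bN j)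
    | bN i, bL j => - dcoef D (bY 0) (bY i) (bL j)
    | _, _ => 0
    end.
  rewrite !mcoeffB u1E u2E u3E; case: i j => i [] j /=; ring.
exists v; split.
  by apply: weighted_sub_inner => // i j; rewrite vE; case: i j => i [] j.
move=> m i j; rewrite dcoef_sub_innerN /coact.
have [|NNij] := boolP (is_N i && is_N j); last rewrite (NND m i j NNij).
  case: i j => // i [] // j _; rewrite (Der_N_NN _ _ _ derD NND) /= !vE; ring.
by case: i j NNij => i [] j //= _; rewrite ?vE ?mulr0 ?addr0 ?subrr.
Qed.

(** * Vanishing on the Y_p *)

Lemma kills_N_into_NN D : kills_N D -> N_into_NN D.
Proof. by move=> ND m i j _; rewrite ND. Qed.

Lemma kills_N_flip D : kills_N D -> kills_N (@flip F \o D).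
Proof. by move=> ND m i j; rewrite dcoef_flip. Qed.

(** When D(N_m) = 0, the two terms on the right of [Der_N_NN] cancel, which
makes the Y (x) L part of D(Y_0) constant along antidiagonals. *)
Lemma kills_N_YL D k i j : esv_Der D -> kills_N D ->
  dcoef D (bY k) (bY i) (bL j) = 0.
Proof.
move=> derD ND; have NND := kills_N_into_NN ND.
rewrite (Der_Y_YL _ _ _ derD NND); move: (i - k) => {}i.
have [R farR] := dcoef_bounded D (bY 0).
pose m : int := (`|R| + `|j| + 2)%N.
have m0 : m%:~R != 0 :> F by apply: contra_not_neq (@intr_inj0 m) _; lia.
have := Der_N_NN m i (j + m) derD NND.
rewrite !ND (farR _ (bL (j + m - 1))) /=; last by right; lia.
rewrite subr0 mulr0 addr0 addrK => /esym/eqP.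
by rewrite mulf_eq0 (negPf m0) => /eqP.
Qed.

Lemma kills_N_LY D k i j : esv_Der D -> kills_N D ->
  dcoef D (bY k) (bL i) (bY j) = 0.
Proof.
move=> derD ND; rewrite -dcoef_flip.
exact: kills_N_YL (esv_Der_flip derD) (kills_N_flip ND).
Qed.

Lemma kills_N_YN D k i j : esv_Der D -> kills_N D ->
  dcoef D (bY k) (bY i) (bN j) = dcoef D (bY 0) (bY (i - k)) (bN j).
Proof.
move=> derD ND; have := Der_relNY derD k 0 (bY i) (bN j).
by rewrite /coact /= !ND addr0 (kills_N_YL _ _ _ derD ND) !mulr0 !addr0 !subr0.
Qed.

Lemma kills_N_NY D k i j : esv_Der D -> kills_N D ->
  dcoef D (bY k) (bN i) (bY j) = dcoef D (bY 0) (bN i) (bY (j - k)).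
Proof.
move=> derD ND; rewrite -!(dcoef_flip D).
exact: kills_N_YN (esv_Der_flip derD) (kills_N_flip ND).
Qed.

(** Let h be the difference of the two sides.  By the Y (x) Y part of the
relation for [Y_k, Y_l], the values h (i - k, j - l) and h (i - l, j - k)
differ by l - k times a coefficient of D(M_(k+l+1)).  Letting k and l
go to infinity in opposite directions with k + l fixed shows that this
coefficient is 0, and then h is constant along antidiagonals. *)
Lemma kills_N_sym D i j : esv_Der D -> kills_N D ->
  dcoef D (bY 0) (bY i) (bN j) = dcoef D (bY 0) (bN i) (bY j).
Proof.
move=> derD ND.
pose h i' j' := dcoef D (bY 0) (bY i') (bN j') - dcoef D (bY 0) (bN i') (bY j').
have YY k l i' j' : (l - k)%:~R * dcoef D (bM (k + l + 1)) (bY i') (bY j') =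
    h (i' - k) (j' - l) - h (i' - l) (j' - k).
  rewrite (Der_relYY derD) /coact /=.
  rewrite !(kills_N_LY _ _ _ derD ND) !(kills_N_YL _ _ _ derD ND).
  rewrite (kills_N_NY k _ _ derD ND) (kills_N_NY l _ _ derD ND).
  rewrite (kills_N_YN k _ _ derD ND) (kills_N_YN l _ _ derD ND) /h.
  by rewrite !mulr0; ring.
have [R farR] := dcoef_bounded D (bY 0).
have h_far i' j' : R < i' \/ R < j' -> h i' j' = 0.
  by move=> far; rewrite /h !farR ?subrr.
have M0 s i' j' : dcoef D (bM s) (bY i') (bY j') = 0.
  pose t : int := (`|R| + `|i'| + `|j'| + `|s| + 2)%N.
  have := YY (- t) (s - 1 + t) i' j'.
  rewrite (_ : - t + (s - 1 + t) + 1 = s); last by ring.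
  rewrite !h_far ?subrr => [/eqP||]; [|by right; lia|by left; lia].
  rewrite mulf_eq0 => /orP[/eqP/intr_inj0|/eqP //]; lia.
pose t : int := (`|R| + `|i| + 1)%N.
have := YY t 0 (i + t) j; rewrite M0 mulr0 addrK !subr0.
rewrite (h_far (i + t)) ?subr0; last by left; lia.
by move/esym/eqP; rewrite subr_eq0 => /eqP.
Qed.

Lemma Der_kills_NY D : esv_Der D -> weighted D -> kills_N D ->
  exists v, kills_N (sub_inner D v) /\
            forall k i j, dcoef (sub_inner D v) (bY k) i j = 0.
Proof.
move=> derD wD ND.
(* Y_k . (N_i (x) N_j) = - Y_(k+i) (x) N_j - N_i (x) Y_(k+j). *)
have [|u uE] := @dcoef_pullback D (bY 0)
  (fun k => if k is (bN i, bN j) then Some (bY i, bN j) else None)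
  (fun k => if k is (bY i, bN j) then (bN i, bN j) else k).
  by move=> [[] i [] j] k' //= [<-].
exists (- u); split=> k i j.
  rewrite dcoef_sub_innerN ND /coact.
  by case: i j => i [] j /=; rewrite ?mcoeffN ?uE /= ?oppr0 ?mulr0 ?addr0 subrr.
rewrite dcoef_sub_innerY /coact.
have [wij|wij] := eqVneq (wt i + wt j)%N 1%N; last first.
  rewrite wD.2 //; case: i j wij => i [] j //= _;
  by rewrite ?mcoeffN ?uE /= ?oppr0 ?mulr0 ?subr0 ?addr0 ?subrr.
case: i j wij => i [] j //= _; rewrite ?mcoeffN ?uE /=
    ?(kills_N_YL _ _ _ derD ND) ?(kills_N_LY _ _ _ derD ND);
  rewrite ?oppr0 ?mulr0 ?sub0r ?add0r ?addr0 ?subr0 ?opprK ?subrr ?oppr0 //.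
- by rewrite (kills_N_NY _ _ _ derD ND) (kills_N_sym _ _ derD ND) subrr.
- by rewrite (kills_N_YN _ _ _ derD ND) subrr.
Qed.

(** * Derivations vanishing on the N_m and the Y_p *)

(** The coefficient of Y_k . u at Y_(i+k) (x) b involves the L_i (x) b and
N_i (x) b coefficients of u, and only the first with a factor depending on k.
So the values k = 0 and k = 1 separate them. *)
Lemma esv_ann_weight0 (u : V) :
    (forall i j, (wt i + wt j != 0)%N -> u@_(i, j) = 0) ->
    (forall k, esv_act << bY k >> u = 0) ->
  u = 0.
Proof.
move=> wu Yu.
have rel k i j : coact (coadY k) (coefs u) i j = 0.
  by rewrite -mcoeff_actY Yu mcoeff0.
have uL i j : wt j = 0%N -> u@_(bL i, j) = 0.
  move=> wj.
  have E k : - (half_int F k - i%:~R / 2) * u@_(bL i, j) - u@_(bN i, j) = 0.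
    have := rel k (bY (i + k)) j; rewrite /coact /= addrK.
    by case: j wj => // j _ /=; rewrite addr0 => ->.
  have := etrans (E 1) (esym (E 0)) => /addIr /eqP; rewrite -subr_eq0 -mulrBl.
  rewrite opprK addrC opprB addrA subrK half_intB sub0r.
  by rewrite mulf_eq0 mulrN1z oppr_eq0 oner_eq0 => /eqP.
have uN i j : wt j = 0%N -> u@_(bN i, j) = 0.
  move=> wj; have := rel 0 (bY i) j; rewrite /coact /= subr0 uL // mulr0 sub0r.
  by case: j wj => // j _ /= /eqP; rewrite addr0 oppr_eq0 => /eqP.
apply/malgP => -[i j]; rewrite mcoeff0.
have [|/wu //] := eqVneq (wt i + wt j)%N 0%N.
by case: i j => i [] j //= _; rewrite ?uL ?uN.
Qed.

Lemma Der_kills_NY_eq0 D : esv_Der D -> kills_N D ->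
  (forall k i j, dcoef D (bY k) i j = 0) -> forall x, D x = 0.
Proof.
move=> derD ND YD.
have N0 m : D << bN m >> = 0.
  by apply/malgP => -[i j]; have := ND m i j; rewrite dcoef.unlock mcoeff0.
have Y0 k : D << bY k >> = 0.
  by apply/malgP => -[i j]; have := YD k i j; rewrite dcoef.unlock mcoeff0.
have M0 n : D << bM n >> = 0.
  have MY k l : (l - k)%:~R *: D << bM (k + l + 1) >> = 0.
    rewrite -half_intB -linearZ -[X in D X]/(esv_bracket_basis F (bY k) (bY l)).
    by rewrite -esv_bracketU derD !Y0 !linear0 addr0.
  (* M_n comes from Y_(1/2) and Y_(n - 1/2), except that n = 1 makes them
     equal; then Y_(-1/2) and Y_(3/2) serve. *)
  have [n1|n1] := eqVneq n 1.
    have := MY (- 1) 1; rewrite n1 (_ : - 1 + 1 + 1 = 1) // => /eqP.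
    by rewrite scaler_eq0 => /orP[/eqP/intr_inj0|/eqP].
  have := MY 0 (n - 1); rewrite add0r subrK => /eqP.
  rewrite scaler_eq0 => /orP[/eqP/intr_inj0|/eqP //].
  by rewrite subr0 => /eqP; rewrite subr_eq0 (negPf n1).
have L0 n : D << bL n >> = 0.
  have actN : esv_act << bN 0 >> (D << bL n >>) = 0.
    have := derD << bN 0 >> << bL n >>; rewrite N0 linear0 subr0 => <-.
    by rewrite esv_bracketU /= oppr0 scale0r linear0.
  apply: esv_ann_weight0 => [i j wij | k].
    have := mcoeff_actN 0 (D << bL n >>) i j; rewrite actN mcoeff0 coactN0.
    move/esym/eqP; rewrite mulf_eq0 (proj1 (pcharf0P F) charF) (negPf wij).
    by move/eqP.
  have := derD << bY k >> << bL n >>; rewrite Y0 linear0 subr0 => <-.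
  by rewrite esv_bracketU linearZ /= Y0 scaler0.
pose z : {linear L -> V} := GRing.null_fun _.
apply: (@linext_eq _ _ _ D z) => -[] m; [exact: L0|exact: M0|exact: N0|exact: Y0].
Qed.

Lemma esv_Der_Inn D : esv_Der D -> esv_Inn D.
Proof.
move=> derD.
have [v1 w1] := Der_weighted derD.
have derD1 := esv_Der_sub_inner v1 derD.
have [v2 [w2 NN2]] := Der_N_into_NN derD1 w1.
have derD2 := esv_Der_sub_inner v2 derD1.
have [v3 [w3 N3]] := Der_kills_N derD2 w2 NN2.
have derD3 := esv_Der_sub_inner v3 derD2.
have [v4 [N4 Y4]] := Der_kills_NY derD3 w3 N3.
have derD4 := esv_Der_sub_inner v4 derD3.
do 4 apply: esv_Inn_sub_inner.
by exists 0 => x; rewrite linear0; exact: Der_kills_NY_eq0 derD4 N4 Y4 x.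
Qed.

Lemma esv_Inn_Der D : esv_Inn D -> esv_Der D.
Proof. by case=> v vE x y; rewrite !vE esv_act_bracket. Qed.

End Derivations.

Theorem theorem3p5 (F : fieldType) (charF : [pchar F] =i pred0) :
  forall D : {linear esv F -> esv2 F}, esv_Der D <-> esv_Inn D.
Proof.
by move=> D; split; [exact: esv_Der_Inn | exact: esv_Inn_Der].
Qed.
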